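(* Let $q$ be an odd prime power, let $k,h,d$ be integers with $0\le k<h<d$, and let $t\ge 2$ be an integer. Let $\mathcal{K}$ be a set of $k$-planes in $\mathbb{F}_q^d$ with \[ |\mathcal{K}|\ge 2(t-1)q^{(d-h)(k+1)}.\] Then the number of $h$-planes in $\mathbb{F}_q^d$ that contain at least $t$ of the $k$-planes in $\mathcal{K}$ is at least $c\,q^{(d-h)(h+1)}$, where \[c=\frac{t-1}{(t-1)+2q^{k(h-k+1)}}.\]
   Context: $\mathbb{F}_q$ is the finite field with $q$ elements. A subset $V\subset\mathbb{F}_q^d$ is a $k$-plane ($k<d$) if there exist $k+1$ vectors $v_1,\ldots,v_{k+1}\in\mathbb{F}_q^d$ with $V=\operatorname{span}\{v_1,\ldots,v_k\}+v_{k+1}$ and $\operatorname{rank}\{v_1,\ldots,v_k\}=k$; that is, $V$ is a $k$-dimensional affine subspace (a $0$-plane is a point). *)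

(* Defs.v *)
From HB Require Import structures.
From mathcomp Require Import all_boot all_order all_algebra.

Set Implicit Arguments.
Unset Strict Implicit.
Unset Printing Implicit Defensive.

Import Order.TTheory GRing.Theory Num.Theory.

Local Open Scope ring_scope.

Definition is_plane (F : finFieldType) (d k : nat) (V : {set 'rV[F]_d}) : bool :=
  [exists vs : k.-tuple 'rV[F]_d, exists w : 'rV[F]_d,
     (\dim <<vs>>%VS == k) && (V == [set x + w | x in <<vs>>%VS])].

Definition rich_planes (F : finFieldType) (d h t : nat)
    (K : {set {set 'rV[F]_d}}) : {set {set 'rV[F]_d}} :=
  [set H | is_plane h H & (t <= #|[set V in K | V \subset H]|)%N].

(* The subtraction in the exponent is truncated; it is used only for k < h. *)
Definition rich_const (q k h t : nat) : rat :=
  (t%:R - 1) / ((t%:R - 1) + 2 * q%:R ^+ (k * (h - k + 1))).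

(* Main.v *)
Require Import Defs.
From HB Require Import structures.
From mathcomp Require Import all_boot all_order all_algebra.
From mathcomp Require Import finfield mxabelem zify ring lra.

Set Implicit Arguments.
Unset Strict Implicit.
Unset Printing Implicit Defensive.

Import Order.TTheory GRing.Theory Num.Theory.

Local Open Scope ring_scope.

(** The affine [k]-planes of F^d are the traces on the hyperplane x_0 = 1 of the
    (k+1)-dimensional linear subspaces of F^(1+d) that meet it, and the
    correspondence preserves inclusion.  A linear subspace containing one that
    meets x_0 = 1 meets it too, so every rich linear subspace comes from a rich
    plane, and it is enough to count rich linear subspaces ([rich_planes_ge]).

    Put q = #|F|, n = 1 + d, j = k + 1, m = h + 1, and let [i] be the q-integer
    1 + q + ... + q^(i-1).  Let W be a uniformly random m-dimensional subspace of
    F^n and X the number of members of K contained in W.  Every j-dimensional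
    subspace lies in the same number D of the N subspaces W, so X has mean
    mu = D|K|/N, which is close to |K| / q^((n-m)j) >= 2(t-1).  A one-sided
    Chebyshev inequality ([cantelli]) then bounds from below the proportion of W
    with X > t - 1, as soon as the variance of X is under control.

    The variance is a spectral quantity.  Let U_i send a function on
    i-dimensional subspaces to the function that sums it over the i-dimensional
    subspaces of an (i+1)-dimensional one.  Two distinct i-dimensional subspaces
    have a common (i+1)-dimensional superspace exactly when they have a common
    (i-1)-dimensional subspace, and each is then unique; so
    U_i^* U_i = U_(i-1) U_(i-1)^* + ([n-i] - [i]) ([commutation]).  By induction
    on i, U_i^* U_i is at most [i][n-i] on functions of sum zero
    ([spectral_gap]).  Composing the U_i for j <= i < m gives
    Var X <= L mu, with L the Gaussian binomial coefficient of h over k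
    ([variance_bound]).

    It remains to compare L, mu and N with the powers of q in the statement.
    For k > 0, L <= 2 q^(k(h-k)) is smaller than q^(k(h-k+1)) by a factor of at
    least q/2, and this absorbs the other errors ([moment_ineq_pos]).  For k = 0 there is no such
    room, since L = 1; there the small defect of mu is compensated by the
    surplus N >= (1 + 1/q) q^((n-m)m) ([moment_ineq_zero]). *)

(** * Double counting and a one-sided Chebyshev inequality *)

Lemma sum_card_rel (A B : finType) (P : {pred A}) (Q : {pred B})
    (r : A -> B -> bool) :
  (\sum_(a in P) #|[set b in Q | r a b]| = \sum_(b in Q) #|[set a in P | r a b]|)%N.
Proof.
transitivity (\sum_(a in P) \sum_(b in Q) r a b)%N.
  by apply: eq_bigr => a _; rewrite -sum1dep_card -big_mkcondr.
rewrite exchange_big; apply: eq_bigr => b _.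
by rewrite -sum1dep_card -big_mkcondr.
Qed.

Lemma card_biregular (A B : finType) (P : {set A}) (Q : {set B})
    (r : A -> B -> bool) x y :
    {in P, forall a, #|[set b in Q | r a b]| = x} ->
    {in Q, forall b, #|[set a in P | r a b]| = y} ->
  (#|P| * x = #|Q| * y)%N.
Proof.
move=> Px Qy; have := sum_card_rel (mem P) (mem Q) r.
by rewrite (eq_bigr _ Px) (eq_bigr _ Qy) !sum_nat_const.
Qed.

Lemma card_biregularR (A B : finType) (P : {set A}) (Q : {set B})
    (r : A -> B -> bool) (x y : rat) :
    {in P, forall a, #|[set b in Q | r a b]|%:R = x} ->
    {in Q, forall b, #|[set a in P | r a b]|%:R = y} ->
  #|P|%:R * x = #|Q|%:R * y.
Proof.
move=> Px Qy; have /(congr1 (fun k => k%:R : rat)) := sum_card_rel (mem P) (mem Q) r.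
by rewrite !natr_sum (eq_bigr _ Px) (eq_bigr _ Qy) !sumr_const !mulr_natl.
Qed.

(** Expanding the square: the Gram matrix of a relation counts common neighbours. *)
Lemma sum_sqr_rel (A B : finType) (P : {set A}) (Q : {set B}) (r : A -> B -> bool)
    (f : A -> rat) :
  \sum_(b in Q) (\sum_(a in P | r a b) f a) ^+ 2 =
  \sum_(a in P) \sum_(a' in P) f a * f a' * #|[set b in Q | r a b && r a' b]|%:R.
Proof.
transitivity (\sum_(b in Q) \sum_(a in P) \sum_(a' in P)
    (if r a b && r a' b then f a * f a' else 0)).
  apply: eq_bigr => b _; rewrite expr2 big_distrl /= big_mkcondr.
  apply: eq_bigr => a _; case: (r a b) => /=; last by rewrite big1.
  by rewrite big_distrr /= big_mkcondr.
rewrite exchange_big; apply: eq_bigr => a _.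
rewrite exchange_big; apply: eq_bigr => a' _.
rewrite -big_mkcondr sumr_const mulr_natr; congr (_ *+ _).
by apply: eq_card => b; rewrite !inE.
Qed.

(** Compare [X] with [mu + a] instead of [mu]: wherever [X i <= s], the square of
    [X i - mu - a] is at least [(mu - s + a) ^+ 2], while its sum over [P] is at most
    [v + #|P| a ^+ 2].  The constant [a = v / (#|P| (mu - s))] is the optimal one. *)
Lemma cantelli (I : finType) (P : {set I}) (X : I -> rat) (mu s v : rat) :
    \sum_(i in P) X i = #|P|%:R * mu ->
    \sum_(i in P) (X i - mu) ^+ 2 <= v -> s < mu ->
  (#|P|%:R * (mu - s)) ^+ 2 <=
    #|[set i in P | s < X i]|%:R * (#|P|%:R * (mu - s) ^+ 2 + v).
Proof.
move=> sX vX lt; set R := #|[set i in P | s < X i]|.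
have v0 : 0 <= v by apply: le_trans vX; apply: sumr_ge0 => i _; apply: sqr_ge0.
set N : rat := #|P|%:R; set d := mu - s; have d0 : 0 < d by rewrite subr_gt0.
have [P0|N0] := posnP #|P|.
  by rewrite /N P0 !mul0r expr0n /= mulr_ge0 ?addr_ge0.
have {}N0 : 0 < N by rewrite ltr0n.
pose a := v / (N * d); have a0 : 0 <= a by rewrite divr_ge0 // mulr_ge0 ?ltW.
have ea : v = N * a * d by rewrite /a; field; rewrite !gt_eqF.
have low : (N - R%:R) * (d + a) ^+ 2 <= \sum_(i in P) (X i - mu - a) ^+ 2.
  rewrite (bigID (fun i => s < X i)) /=; apply: ler_wpDl.
    by apply: sumr_ge0 => i _; apply: sqr_ge0.
  have -> : (N - R%:R) * (d + a) ^+ 2 = \sum_(i in P | ~~ (s < X i)) (d + a) ^+ 2.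
    rewrite sumr_const -[RHS]mulr_natl; congr (_ * _).
    rewrite /N /R -(cardsID [set i | s < X i] P) natrD.
    rewrite (_ : [set i in P | s < X i] = P :&: [set i | s < X i]); last by apply/setP=> i; rewrite !inE.
    by rewrite addrC addKr; congr (_%:R); apply: eq_card => i; rewrite !inE andbC.
  by apply: ler_sum => i /andP[_]; rewrite -leNgt => le; rewrite /d; nra.
have : \sum_(i in P) (X i - mu - a) ^+ 2 = \sum_(i in P) (X i - mu) ^+ 2 + N * a ^+ 2.
  transitivity (\sum_(i in P) ((X i - mu) ^+ 2 - 2 * a * (X i - mu) + a ^+ 2)).
    by apply: eq_bigr => i _; ring.
  rewrite big_split /= sumrB -big_distrr /= sumrB sX !sumr_const -[mu *+ _]mulr_natl -[_ ^+ 2 *+ _]mulr_natl -/N.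
  by rewrite subrr mulr0 subr0.
move=> e; rewrite e in low; have {low} := le_trans low (lerD vX (lexx _)).
rewrite {1}ea => low.
have da0 : 0 < d + a by rewrite ltr_wpDr.
have {}low : (N - R%:R) * (d + a) <= N * a.
  rewrite -(ler_pM2r da0) -mulrA -expr2; apply: le_trans low _.
  by rewrite le_eqVlt; apply/orP; left; apply/eqP; ring.
have Nd : N * d <= R%:R * (d + a).
  by move: low; rewrite mulrBl mulrDr lerBlDr addrC lerD2l.
have {Nd} := ler_wpM2l (ltW (mulr_gt0 N0 d0)) Nd; rewrite ea -expr2.
move/le_trans; apply; rewrite le_eqVlt; apply/orP; left; apply/eqP; ring.
Qed.

(** * q-integers *)

Definition qint (q j : nat) : nat := (\sum_(i < j) q ^ i)%N.

Lemma qint0 q : qint q 0 = 0%N. Proof. by rewrite /qint big_ord0. Qed.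
Lemma qint1 q : qint q 1 = 1%N. Proof. by rewrite /qint big_ord1. Qed.
Lemma qintSr q j : qint q j.+1 = (qint q j + q ^ j)%N.
Proof. by rewrite /qint big_ord_recr. Qed.
Lemma qintD q i j : qint q (i + j) = (qint q i + q ^ i * qint q j)%N.
Proof.
rewrite /qint big_split_ord /= big_distrr /=; congr (_ + _)%N.
by apply: eq_bigr => l _; rewrite expnD.
Qed.
Lemma qintSl q j : qint q j.+1 = (1 + q * qint q j)%N.
Proof. by rewrite -add1n qintD qint1 expn1. Qed.
Lemma qint_gt0 q j : (0 < j)%N -> (0 < qint q j)%N.
Proof. by case: j => // j _; rewrite qintSl. Qed.

Lemma expB_qint q i m : (i <= m)%N ->
  (q ^ m - q ^ i = (q ^ i.+1 - q ^ i) * qint q (m - i))%N.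
Proof.
move=> le_im; rewrite -[in LHS](subnKC le_im) expnD.
have := predn_exp q (m - i); rewrite -/(qint _ _) => e.
rewrite -[X in (_ - X)%N]muln1 -mulnBr subn1 e mulnA; congr (_ * _)%N.
by rewrite mulnC -subn1 mulnBl mul1n expnS.
Qed.

(** * Counting subspaces between two given ones *)

Section Grassmannian.
Variables (F : finFieldType) (n : nat).
Local Notation q := #|F|.
Local Notation "[ j ]" := (qint q j) (at level 0).

(** The canonical generator matrix [<<A>>] is determined by the row space of [A], so
    these matrices name each [j]-dimensional subspace once and inclusion is [<=] in
    [%MS].  Locked so that membership is not unfolded into its two conditions. *)
Definition Gr (j : nat) : {set 'M[F]_n} :=
  locked [set A | (<<A>>%MS == A) && (\rank A == j)].

Lemma in_Gr j A : (A \in Gr j) = (<<A>>%MS == A) && (\rank A == j).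
Proof. by rewrite /Gr -lock inE. Qed.

Lemma mem_genmx_Gr m (A : 'M[F]_(m, n)) : <<A>>%MS \in Gr (\rank A).
Proof. by rewrite in_Gr genmx_id mxrank_gen !eqxx. Qed.

Lemma rank_Gr j A : A \in Gr j -> \rank A = j.
Proof. by rewrite in_Gr => /andP[_ /eqP]. Qed.

Lemma Gr_inj i j A B : A \in Gr i -> B \in Gr j ->
  (A <= B)%MS -> (j <= i)%N -> A = B.
Proof.
move=> Ai Bj AB ji; move: (Ai) (Bj); rewrite !in_Gr => /andP[/eqP<- _] /andP[/eqP<- _].
apply/genmxP; rewrite AB /= -(geq_leqif (mxrank_leqif_sup AB)).
by rewrite (rank_Gr Ai) (rank_Gr Bj).
Qed.

Lemma Gr0E : Gr 0 = [set 0].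
Proof.
apply/setP=> A; rewrite !inE in_Gr mxrank_eq0 andbC.
by apply: andb_idr => /eqP->; rewrite genmx0.
Qed.

Lemma Gr0_sub V m (W : 'M[F]_(m, n)) : V \in Gr 0 -> (V <= W)%MS.
Proof. by rewrite Gr0E inE => /eqP->; apply: sub0mx. Qed.

Lemma card_submx m (A : 'M[F]_(m, n)) :
  #|[set x : 'rV[F]_n | (x <= A)%MS]| = (q ^ \rank A)%N.
Proof. exact: card_rowg. Qed.

Lemma card_submxD m m' (A : 'M[F]_(m, n)) (B : 'M[F]_(m', n)) : (B <= A)%MS ->
  #|[set x : 'rV[F]_n | (x <= A)%MS && ~~ (x <= B)%MS]|
    = (q ^ \rank A - q ^ \rank B)%N.
Proof.
move=> BA; rewrite -!card_submx -(cardsID [set x | (x <= B)%MS] [set x | (x <= A)%MS]).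
rewrite (_ : _ :&: _ = [set x | (x <= B)%MS]); last first.
  by apply/setP=> x; rewrite !inE andb_idl // => /submx_trans; apply.
by rewrite addKn; congr #|pred_of_set _|; apply/setP=> x; rewrite !inE andbC.
Qed.

(** Every vector of [W] outside [V] spans with [V] exactly one [U], and each [U]
    arises from [q ^ i.+1 - q ^ i] vectors. *)
Lemma card_cover (i m : nat) V (W : 'M[F]_n) : V \in Gr i -> \rank W = m -> (V <= W)%MS ->
  #|[set U in Gr i.+1 | (V <= U)%MS && (U <= W)%MS]| = [m - i].
Proof.
move=> Vi Wm VW.
have le_im : (i <= m)%N by rewrite -(rank_Gr Vi) -Wm mxrankS.
set T := [set U in _ | _].
pose S := [set x : 'rV[F]_n | (x <= W)%MS && ~~ (x <= V)%MS].
have rkVx x : x \in S -> \rank (V + x)%MS = i.+1.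
  rewrite inE => /andP[_ xV]; apply/eqP; rewrite eqn_leq; apply/andP; split.
    by apply: leq_trans (mxrank_adds_leqif _ _) _; rewrite (rank_Gr Vi) (leq_trans (leq_add (leqnn i) (rank_leq_row x))) ?addn1.
  rewrite -(rank_Gr Vi) ltnNge (geq_leqif (mxrank_leqif_sup (addsmxSl V x))).
  by rewrite addsmx_sub negb_and xV orbT.
have Tx : {in T, forall U, #|[set x in S | (x <= U)%MS]| = (q ^ i.+1 - q ^ i)%N}.
  move=> U; rewrite inE => /andP[Ui /andP[VU UW]].
  rewrite -(rank_Gr Ui) -(rank_Gr Vi) -card_submxD //; congr #|pred_of_set _|.
  apply/setP=> x; rewrite !inE andbC.
  by case xU: (x <= U)%MS; rewrite //= (submx_trans xU UW).
have Sx : {in S, forall x : 'rV_n, #|[set U in T | (x <= U)%MS]| = 1%N}.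
  move=> x Sx; have rk := rkVx x Sx; move: (Sx); rewrite inE => /andP[xW xV].
  apply/eqP/cards1P; exists <<(V + x)%MS>>%MS; apply/setP=> U; rewrite !inE.
  apply/idP/eqP=> [/andP[/andP[Ui /andP[VU UW]] xU]|->]; last first.
    by rewrite in_Gr genmx_id !genmxE rk !eqxx addsmxSl addsmxSr addsmx_sub VW xW.
  symmetry; apply: (@Gr_inj i.+1 i.+1); rewrite ?leqnn //.
  - by rewrite -rk mem_genmx_Gr.
  - by rewrite genmxE addsmx_sub VU.
have := card_biregular Tx Sx; rewrite card_submxD // Wm (rank_Gr Vi) muln1.
rewrite (expB_qint q le_im) mulnC => /eqP; rewrite eqn_pmul2l ?subn_gt0 ?ltn_exp2l ?finNzRing_gt1 //.
by move/eqP.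
Qed.

(** Double counting of the pairs [V < V1 <= U < W] with [V1] a cover of [V], by
    induction on the codimension; this avoids duality. *)
Lemma card_hyper i m V W : V \in Gr i -> W \in Gr m.+1 -> (V <= W)%MS -> (i <= m)%N ->
  #|[set U in Gr m | (V <= U)%MS && (U <= W)%MS]| = [m.+1 - i].
Proof.
move=> + Wm + le_im; have [j ->] : exists j, i = (m - j)%N by exists (m - i)%N; lia.
elim: j V => [|j IH] V.
  rewrite subn0 subSnn qint1 => Vm VW; apply/eqP/cards1P; exists V.
  apply/setP=> U; rewrite !inE.
  apply/idP/eqP=> [/andP[Um /andP[VU UW]]|->].
    by symmetry; apply: Gr_inj Vm Um VU _.
  by rewrite submx_refl VW Vm.
have [le_mj|lt_jm] := leqP m j.
  have -> : (m - j.+1 = m - j)%N by lia.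
  exact: IH.
move=> Vm VW; set B := [set U in _ | _].
pose i' := (m - j.+1)%N; have ei' : (m - j = i'.+1)%N by rewrite /i'; lia.
pose A := [set U in Gr i'.+1 | (V <= U)%MS && (U <= W)%MS].
have cA : #|A| = [m.+1 - i'] by apply: card_cover => //; apply: rank_Gr.
have Ax : {in A, forall U, #|[set U' in B | (U <= U')%MS]| = [m - i']}.
  move=> U; rewrite inE => /andP[Ui /andP[VU UW]].
  have -> : (m - i' = m.+1 - (m - j))%N by rewrite ei'.
  rewrite -(IH U) ?ei' //; congr #|pred_of_set _|; apply/setP=> U'; rewrite !inE.
  by case UU': (U <= U')%MS; rewrite /= ?andbF // (submx_trans VU UU') andbT.
have Bx : {in B, forall U', #|[set U in A | (U <= U')%MS]| = [m - i']}.
  move=> U; rewrite inE => /andP[Ui /andP[VU UW]].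
  rewrite -(card_cover Vm (rank_Gr Ui) VU); congr #|pred_of_set _|; apply/setP=> U'.
  by rewrite !inE; case UU': (U' <= U)%MS; rewrite ?andbF // (submx_trans UU' UW) !andbT.
have := card_biregular Ax Bx; rewrite cA => /eqP.
rewrite eqn_pmul2r; first by move/eqP=> <-.
by apply: qint_gt0; rewrite /i'; lia.
Qed.

Lemma card_above V i : V \in Gr i -> #|[set U in Gr i.+1 | (V <= U)%MS]| = [n - i].
Proof.
move=> Vi; rewrite -(card_cover Vi (mxrank1 F n) (submx1 V)).
by congr #|pred_of_set _|; apply/setP=> U; rewrite !inE submx1 andbT.
Qed.

Lemma card_below1 U m : U \in Gr m.+1 -> #|[set V in Gr m | (V <= U)%MS]| = [m.+1].
Proof.
move=> Um; have Z : (0 : 'M[F]_n) \in Gr 0 by rewrite Gr0E inE.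
rewrite -[m.+1]subn0 -(card_hyper Z Um) ?sub0mx //.
by congr #|pred_of_set _|; apply/setP=> V; rewrite !inE sub0mx.
Qed.

(** * Numbers of subspaces above and below a given one *)

(** The Gaussian binomial coefficient of [n - i] over [m - i], as a product that
    lowers both arguments together, the form that suits an induction on [i]. *)
Definition nb_over (i m : nat) : rat := \prod_(i <= l < m) ([n - l]%:R / [m - l]%:R).
(** The Gaussian binomial coefficient of [m] over [j]. *)
Definition below (m j : nat) : rat := \prod_(0 <= l < j) ([m - l]%:R / [l.+1]%:R).

Lemma qintR_gt0 j : (0 < j)%N -> 0 < [j]%:R :> rat.
Proof. by move=> j0; rewrite ltr0n qint_gt0. Qed.

Lemma nb_over_recl i m : (i < m)%N -> nb_over i m * [m - i]%:R = [n - i]%:R * nb_over i.+1 m.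
Proof.
move=> im; rewrite /nb_over big_ltn //; have : [m - i]%:R != 0 :> rat.
  by rewrite gt_eqF // qintR_gt0 // subn_gt0.
by move=> ?; field.
Qed.

Lemma nb_overii i : nb_over i i = 1.
Proof. by rewrite /nb_over big_geq. Qed.

(** The same product with its denominators in increasing order, which gives the
    recursion on [m]. *)
Lemma nb_over_recr i m : (i <= m)%N -> nb_over i m.+1 * [m.+1 - i]%:R = nb_over i m * [n - m]%:R.
Proof.
move=> im; have D k : nb_over i k = (\prod_(i <= l < k) [n - l]%:R) /
   \prod_(i <= l < k) [l.+1 - i]%:R.
  rewrite /nb_over prodf_div; congr (_ / _).
  rewrite big_nat_rev; apply: eq_big_nat => l lk; congr ([_]%:R); lia.
rewrite !D !big_nat_recr //=.
have : [m.+1 - i]%:R != 0 :> rat by rewrite gt_eqF // qintR_gt0 // subn_gt0.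
have : \prod_(i <= l < m) [l.+1 - i]%:R != 0 :> rat.
  rewrite prodf_seq_neq0; apply/allP => l; rewrite mem_index_iota => /andP[il _] /=.
  by rewrite gt_eqF // qintR_gt0 // subn_gt0.
by move=> ? ?; field; apply/andP.
Qed.

Lemma nb_over_gt0 i m : (m <= n)%N -> 0 < nb_over i m.
Proof.
move=> mn; rewrite /nb_over big_nat; apply: prodr_gt0 => l /andP[_ lm].
by apply: divr_gt0; apply: qintR_gt0; lia.
Qed.

Lemma card_over V i m : V \in Gr i -> (i <= m <= n)%N ->
  #|[set U in Gr m | (V <= U)%MS]|%:R = nb_over i m.
Proof.
move=> + /andP[im mn]; have [j ->] : exists j, i = (m - j)%N by exists (m - i)%N; lia.
elim: j V {im} => [|j IH] V.
  rewrite subn0 nb_overii => Vm; apply/eqP; rewrite pnatr_eq1; apply/cards1P; exists V.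
  apply/setP=> U; rewrite !inE; apply/idP/eqP=> [/andP[Um VU]|->].
    by symmetry; apply: Gr_inj Vm Um VU _.
  by rewrite submx_refl Vm.
have [le_mj|lt_jm] := leqP m j.
  have -> : (m - j.+1 = m - j)%N by lia.
  exact: IH.
set l := (m - j.+1)%N; have el : (m - j = l.+1)%N by rewrite /l; lia.
rewrite el in IH => Vl.
pose A := [set U in Gr l.+1 | (V <= U)%MS].
have Ax : {in A, forall U, #|[set U' in [set U in Gr m | (V <= U)%MS] | (U <= U')%MS]|%:R = nb_over l.+1 m}.
  move=> U; rewrite inE => /andP[Ui VU].
  rewrite -(IH U) //; congr (#|pred_of_set _|%:R); apply/setP=> U'; rewrite !inE.
  by case UU': (U <= U')%MS; rewrite /= ?andbF // (submx_trans VU UU') andbT.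
have Bx : {in [set U in Gr m | (V <= U)%MS], forall U', #|[set U in A | (U <= U')%MS]|%:R = [m - l]%:R :> rat}.
  move=> U; rewrite inE => /andP[Ui VU].
  rewrite -(card_cover Vl (rank_Gr Ui) VU); congr (#|pred_of_set _|%:R); apply/setP=> U'.
  by rewrite !inE -andbA.
have := card_biregularR Ax Bx; rewrite card_above // -nb_over_recl; last by lia.
by move/mulIf=> ->//; rewrite gt_eqF // qintR_gt0 //; lia.
Qed.

Lemma card_below W m j : W \in Gr m -> (j <= m)%N ->
  #|[set V in Gr j | (V <= W)%MS]|%:R = below m j.
Proof.
move=> Wm; elim: j => [|j IH] jm.
  rewrite /below big_geq //; apply/eqP; rewrite pnatr_eq1; apply/cards1P; exists 0.
  apply/setP=> U; rewrite inE Gr0E !inE; apply/idP/eqP => [/andP[/eqP]//|->].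
  by rewrite eqxx sub0mx.
rewrite /below big_nat_recr //= -/(below m j) -IH 1?ltnW //.
have Ax : {in [set V in Gr j | (V <= W)%MS], forall V,
   #|[set U in [set V in Gr j.+1 | (V <= W)%MS] | (V <= U)%MS]|%:R = [m - j]%:R :> rat}.
  move=> V; rewrite inE => /andP[Vj VW].
  rewrite -(card_cover Vj (rank_Gr Wm) VW); congr (#|pred_of_set _|%:R); apply/setP=> U.
  by rewrite !inE -andbA; congr (_ && _); rewrite andbC.
have Bx : {in [set V in Gr j.+1 | (V <= W)%MS], forall U,
   #|[set V in [set V in Gr j | (V <= W)%MS] | (V <= U)%MS]|%:R = [j.+1]%:R :> rat}.
  move=> U; rewrite inE => /andP[Uj UW].
  rewrite -(card_below1 Uj); congr (#|pred_of_set _|%:R); apply/setP=> V; rewrite !inE.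
  by case VU: (V <= U)%MS; rewrite ?andbF // (submx_trans VU UW) !andbT.
have := card_biregularR Ax Bx; rewrite mulrA => ->; rewrite mulfK //.
by rewrite gt_eqF // qintR_gt0.
Qed.

Lemma card_Gr j : (j <= n)%N -> #|Gr j|%:R = nb_over 0 j.
Proof.
move=> jn; have Z : (0 : 'M[F]_n) \in Gr 0 by rewrite Gr0E inE.
rewrite -(card_over Z) ?jn //; congr (#|pred_of_set _|%:R).
by apply/setP=> U; rewrite !inE sub0mx andbT.
Qed.

(** * The spectral gap of the inclusion operators *)

Definition up (j : nat) (f : 'M[F]_n -> rat) (W : 'M[F]_n) : rat :=
  \sum_(V in Gr j | (V <= W)%MS) f V.
Definition down (m : nat) (f : 'M[F]_n -> rat) (U : 'M[F]_n) : rat :=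
  \sum_(V in Gr m | (U <= V)%MS) f V.
Local Notation sqnorm j f := (\sum_(V in Gr j) f V ^+ 2).

Lemma up_down_adjoint j m f g :
  \sum_(W in Gr m) f W * up j g W = \sum_(V in Gr j) down m f V * g V.
Proof.
under eq_bigr do rewrite /up big_distrr /= big_mkcondr.
under [RHS]eq_bigr do rewrite /down big_distrl /= big_mkcondr.
exact: exchange_big.
Qed.

Lemma sum_up j m f : (j <= m <= n)%N ->
  \sum_(W in Gr m) up j f W = nb_over j m * \sum_(V in Gr j) f V.
Proof.
move=> jm; rewrite big_distrr /=.
have := up_down_adjoint j m (fun=> 1) f; under [X in X = _ -> _]eq_bigr do rewrite mul1r.
move=> ->; apply: eq_bigr => V Vj; congr (_ * _).
rewrite -(card_over Vj jm) /down sumr_const; congr (_ *+ _).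
by apply: eq_card => U; rewrite !inE.
Qed.

Lemma sum_down j f :
  \sum_(U in Gr j) down j.+1 f U = [j.+1]%:R * \sum_(V in Gr j.+1) f V.
Proof.
rewrite big_distrr /=.
have := up_down_adjoint j j.+1 f (fun=> 1); under [X in _ = X -> _]eq_bigr do rewrite mulr1.
move=> <-; apply: eq_bigr => V Vj; rewrite mulrC; congr (_ * _).
rewrite -(card_below1 Vj) /up sumr_const; congr (_ *+ _).
by apply: eq_card => U; rewrite !inE.
Qed.

(** By the dimension formula both sides are [1] or [0] according to whether
    [V :&: V'] has dimension [j] or less: the join, respectively the meet, is the only
    candidate. *)
Lemma card_join_meet j V V' : V \in Gr j.+1 -> V' \in Gr j.+1 -> V != V' ->
  #|[set W in Gr j.+2 | (V <= W)%MS && (V' <= W)%MS]|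
    = #|[set U in Gr j | (U <= V)%MS && (U <= V')%MS]|.
Proof.
move=> Vj Vj' neq; have := mxrank_sum_cap V V'; rewrite (rank_Gr Vj) (rank_Gr Vj').
have capj : (\rank (V :&: V')%MS <= j)%N.
  rewrite leqNgt; apply: contra neq => lt; apply/eqP.
  have cV : (V <= V :&: V')%MS.
    rewrite -(geq_leqif (mxrank_leqif_sup (capmxSl V V'))) (rank_Gr Vj) //.
  by apply: (Gr_inj Vj Vj') => //; apply: submx_trans cV (capmxSr _ _).
have [e rks|ne rks] := eqVneq (\rank (V :&: V')%MS) j.
  have {}rks : \rank (V + V')%MS = j.+2 by lia.
  transitivity 1%N; last symmetry; apply/eqP/cards1P.
    exists <<(V + V')%MS>>%MS; apply/setP=> W; rewrite !inE -addsmx_sub.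
    apply/idP/eqP=> [/andP[Wj sW]|->]; last by rewrite -rks mem_genmx_Gr genmxE submx_refl.
    by symmetry; apply: (@Gr_inj j.+2 j.+2); rewrite ?genmxE // -rks mem_genmx_Gr.
  exists <<(V :&: V')%MS>>%MS; apply/setP=> W; rewrite !inE -sub_capmx.
  apply/idP/eqP=> [/andP[Wj sW]|->]; last by rewrite -[X in Gr X]e mem_genmx_Gr genmxE submx_refl.
  by apply: (@Gr_inj j j); rewrite ?genmxE // -[X in Gr X]e mem_genmx_Gr.
transitivity 0%N; last symmetry; apply: eq_card0 => W; rewrite !inE; apply/negP; last first.
  rewrite -sub_capmx => /andP[Wj /mxrankS]; rewrite (rank_Gr Wj); lia.
rewrite -addsmx_sub => /andP[Wj /mxrankS]; rewrite (rank_Gr Wj); lia.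
Qed.

(** Off the diagonal the two Gram matrices agree by [card_join_meet]; the
    diagonals are the numbers of covers and of hyperplanes of a [j.+1]-dimensional
    subspace. *)
Lemma commutation j f :
  sqnorm j.+2 (up j.+1 f) =
    sqnorm j (down j.+1 f) + ([n - j.+1]%:R - [j.+1]%:R) * sqnorm j.+1 f.
Proof.
rewrite (sum_sqr_rel (Gr j.+1) (Gr j.+2) (fun V W => (V <= W)%MS)).
rewrite (sum_sqr_rel (Gr j.+1) (Gr j) (fun V W => (W <= V)%MS)).
rewrite big_distrr -big_split /=; apply: eq_bigr => V Vj.
rewrite (bigD1 V) //= [in RHS](bigD1 V) //= addrAC; congr (_ + _).
  rewrite (eq_card (B := [set U in Gr j.+2 | (V <= U)%MS])); last by move=> U; rewrite !inE andbb.
  rewrite card_above // (eq_card (B := [set U in Gr j | (U <= V)%MS])); last by move=> U; rewrite !inE andbb.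
  by rewrite card_below1 //; ring.
by apply: eq_bigr => V' /andP[Vj' neq]; rewrite card_join_meet // eq_sym.
Qed.

(** Induction on [j] through [commutation].  An operator and its adjoint have the
    same norm, so the bound for [up j] on functions of sum zero is also a bound for
    [down j.+1], which preserves sum zero. *)
Lemma spectral_gap j f : (j <= n)%N -> \sum_(V in Gr j) f V = 0 ->
  sqnorm j.+1 (up j f) <= [j]%:R * [n - j]%:R * sqnorm j f.
Proof.
elim: j f => [|j IH] f jn f0.
  rewrite qint0 !mul0r big1 // => W _; rewrite /up.
  rewrite (eq_bigl (mem (Gr 0))) ?f0 ?expr0n // => V.
  by apply: andb_idr => /Gr0_sub->.
rewrite commutation.
set g := down j.+1 f; set S := sqnorm j.+1 f.
have S0 : 0 <= S by apply: sumr_ge0 => V _; apply: sqr_ge0.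
have ub : sqnorm j g <= [j]%:R * [n - j]%:R * S.
  (* For [j = 0] the bound is [0]: the only subspace is [0], where [down j.+1 f] is the
     sum of [f]. *)
  case: (posnP j) => [j0|jpos].
    rewrite big1 ?j0 ?qint0 ?mul0r // => U Uj; rewrite /g /down.
    rewrite (eq_bigl (mem (Gr j.+1))) ?f0 ?expr0n // => V.
    by apply: andb_idr => _; apply: Gr0_sub.
  have g0 : \sum_(U in Gr j) g U = 0 by rewrite sum_down f0 mulr0.
  have := IH g (ltnW jn) g0.
  have: \sum_(V in Gr j.+1) f V * up j g V = sqnorm j g.
    by rewrite up_down_adjoint; apply: eq_bigr => U _; rewrite expr2.
  have : 0 < [j]%:R * [n - j]%:R :> rat by rewrite mulr_gt0 // qintR_gt0 // subn_gt0.
  move: ([j]%:R * _) => a a0 eg le.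
  (* Norm of the adjoint: expand this square, with [a] the bound on [up j]. *)
  have : 0 <= \sum_(V in Gr j.+1) (a * f V - up j g V) ^+ 2 by apply: sumr_ge0 => V _; apply: sqr_ge0.
  have -> : \sum_(V in Gr j.+1) (a * f V - up j g V) ^+ 2 =
     a ^+ 2 * S - 2 * a * sqnorm j g + sqnorm j.+1 (up j g).
    rewrite -eg /S !big_distrr -sumrB -big_split /=; apply: eq_bigr => V _; ring.
  move=> ge; rewrite -(ler_pM2l a0); nra.
apply: le_trans (lerD ub (lexx _)) _; rewrite -mulrDl; apply: ler_wpM2r => //.
have -> : (n - j = (n - j.+1).+1)%N by lia.
rewrite !qintSl !natrD !natrM.
have : 1 <= #|F|%:R :> rat by rewrite ler1n; apply: ltnW; apply: finNzRing_gt1.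
have : 0 <= [j]%:R :> rat by rewrite ler0n.
have : 0 <= [n - j.+1]%:R :> rat by rewrite ler0n.
move: (_%:R) => b; move: (_%:R) => a; move: (_%:R) => r; nra.
Qed.

(** An intermediate [m]-dimensional subspace can be chosen in [[m.+1 - j]] ways. *)
Lemma up_up j m f W : W \in Gr m.+1 -> (j <= m)%N ->
  up m (up j f) W = [m.+1 - j]%:R * up j f W.
Proof.
move=> Wm jm; rewrite /up big_distrr /=.
under eq_bigr do rewrite big_mkcondr.
rewrite exchange_big [RHS]big_mkcondr; apply: eq_bigr => V Vj.
rewrite -big_mkcondr sumr_const /=; case: ifP => VW.
  rewrite -[LHS]mulr_natl -(card_hyper Vj Wm VW jm); congr (_%:R * _).
  by apply: eq_card => U; rewrite !inE -[LHS]/[&& (U \in Gr m) && (U <= W)%MS & (V <= U)%MS]; case: (U \in Gr m); case: (U <= W)%MS; case: (V <= U)%MS.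
rewrite eq_card0 // => U; apply/negP => /andP[/andP[_ UW] VU].
by rewrite (submx_trans VU UW) in VW.
Qed.

(** The Gaussian binomial coefficient of [m - 1] over [j - 1]. *)
Definition var_factor (j m : nat) : rat := \prod_(j <= l < m) ([l]%:R / [l.+1 - j]%:R).

(** Composition of the bounds of [spectral_gap]; [up_up] keeps track of the
    multiplicities.  The part [nb_over j m] is the number of summation sets in which each
    [V] occurs, so that [var_factor j m] is the ratio of variance to mean. *)
Lemma up_norm j m f : (j <= m <= n)%N -> \sum_(V in Gr j) f V = 0 ->
  sqnorm m (up j f) <= var_factor j m * nb_over j m * sqnorm j f.
Proof.
move=> /andP[+ +] f0; elim: m => [|m IH].
  rewrite leqn0 => /eqP-> _; rewrite nb_overii /var_factor big_geq // !mul1r.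
  apply: ler_sum => W Wj; rewrite /up (bigD1 W) ?Wj ?submx_refl //= big1 ?addr0 //.
  by move=> V /andP[/andP[Vj VW]]; rewrite (Gr_inj Vj Wj) ?eqxx.
rewrite leq_eqVlt => /predU1P[<- _|].
  rewrite nb_overii /var_factor big_geq // !mul1r.
  apply: ler_sum => W Wj; rewrite /up (bigD1 W) ?Wj ?submx_refl //= big1 ?addr0 //.
  by move=> V /andP[/andP[Vj VW]]; rewrite (Gr_inj Vj Wj) ?eqxx.
rewrite ltnS => jm mn; have {}IH := IH jm (ltnW mn).
have x0 : 0 < [m.+1 - j]%:R :> rat by rewrite qintR_gt0 // subn_gt0.
have up0 : \sum_(U in Gr m) up j f U = 0 by rewrite sum_up ?f0 ?mulr0 // jm ltnW.
have := spectral_gap (ltnW mn) up0.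
have -> : sqnorm m.+1 (up m (up j f)) = [m.+1 - j]%:R ^+ 2 * sqnorm m.+1 (up j f).
  by rewrite big_distrr; apply: eq_bigr => W Wm; rewrite up_up // exprMn.
move=> le; rewrite -(ler_pM2l (exprn_gt0 2 x0)); apply: le_trans le _.
have -> : [m.+1 - j]%:R ^+ 2 * (var_factor j m.+1 * nb_over j m.+1 * sqnorm j f)
   = [m]%:R * [n - m]%:R * (var_factor j m * nb_over j m * sqnorm j f).
  rewrite (_ : var_factor j m.+1 = var_factor j m * ([m]%:R / [m.+1 - j]%:R)); last by rewrite /var_factor big_nat_recr.
  transitivity ((nb_over j m.+1 * [m.+1 - j]%:R) * (var_factor j m * [m]%:R) * sqnorm j f).
    by field; rewrite gt_eqF.
  by rewrite nb_over_recr //; ring.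
by apply: ler_wpM2l => //; rewrite mulr_ge0 ?ler0n.
Qed.

(** Apply [up_norm] to the indicator function of [K] minus its average. *)
Lemma variance_bound j m (K : {set 'M[F]_n}) : (j <= m <= n)%N -> K \subset Gr j ->
  let X W : rat := #|[set V in K | (V <= W)%MS]|%:R in
  let mu := nb_over j m * #|K|%:R / nb_over 0 m in
  \sum_(W in Gr m) X W = #|Gr m|%:R * mu /\
  \sum_(W in Gr m) (X W - mu) ^+ 2 <= var_factor j m * nb_over j m * #|K|%:R.
Proof.
move=> /andP[jm mn] KG X mu; pose one V : rat := (V \in K)%:R.
have jn := leq_trans jm mn.
have jmn : (j <= m <= n)%N by rewrite jm.
have N0 : 0 < nb_over 0 m by apply: nb_over_gt0.
have Nj0 : 0 < nb_over 0 j by apply: nb_over_gt0.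
have sone : \sum_(V in Gr j) one V = #|K|%:R.
  rewrite -sum1_card natr_sum (big_setID K) /= (setIidPr KG) [X in _ + X]big1 ?addr0.
    by apply: eq_bigr => V; rewrite /one => ->.
  by move=> V; rewrite /one inE => /andP[/negPf->].
have upone W : up j one W = X W.
  rewrite /up /X -sum1_card natr_sum /one big_mkcond /= [RHS]big_mkcond /=.
  apply: eq_bigr => V _; rewrite !inE.
  case VK: (V \in K); first by rewrite (subsetP KG) //=; case: ifP.
  by case: ifP.
have sX : \sum_(W in Gr m) X W = #|Gr m|%:R * mu.
  under eq_bigr do rewrite -upone; rewrite sum_up // sone card_Gr // /mu.
  by field; rewrite gt_eqF.
split=> //; pose c := #|K|%:R / nb_over 0 j; pose f V := one V - c.
have f0 : \sum_(V in Gr j) f V = 0.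
  rewrite sumrB sone sumr_const -[c *+ _]mulr_natl card_Gr // /c.
  by field; rewrite gt_eqF.
have upf W : W \in Gr m -> up j f W = X W - c * below m j.
  move=> Wm; rewrite /up sumrB -/(up j one W) upone sumr_const -(card_below Wm jm) mulr_natr.
  by congr (_ - _ *+ _); apply: eq_card => V; rewrite !inE.
have emu : mu = c * below m j.
  have := sum_up f jmn; rewrite f0 mulr0 (eq_bigr _ upf) sumrB sX sumr_const -[X in _ - X]mulr_natl.
  rewrite -mulrBr => /eqP; rewrite mulf_eq0 card_Gr // gt_eqF //= subr_eq0 => /eqP; exact.
have -> : \sum_(W in Gr m) (X W - mu) ^+ 2 = sqnorm m (up j f).
  by apply: eq_bigr => W Wm; rewrite upf // emu.
apply: le_trans (up_norm jmn f0) _.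
have L0 : 0 <= var_factor j m * nb_over j m.
  rewrite mulr_ge0 ?(ltW (nb_over_gt0 _ _)) // /var_factor prodr_ge0 // => l _.
  by rewrite divr_ge0 ?ler0n.
apply: ler_wpM2l => //.
have -> : sqnorm j f = \sum_(V in Gr j) one V - c * \sum_(V in Gr j) (one V + f V).
  rewrite big_distrr -sumrB; apply: eq_bigr => V _; rewrite /f /one.
  by case: (V \in K) => /=; ring.
rewrite big_split /= f0 sone addr0 lerBlDr lerDl mulr_ge0 ?ler0n // /c.
by rewrite divr_ge0 ?ler0n // ltW.
Qed.

(** * Comparison with powers of q *)

Lemma qintB_expR a b : q%:R ^+ a * [b]%:R = [a + b]%:R - [a]%:R :> rat.
Proof. by rewrite qintD natrD natrM natrX; ring. Qed.

(** With [m = i + c.+1], each factor of the product is at least [q ^+ (n - m)]; the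
    last one, the q-integer of [n - m + 1], also has the term [q ^+ (n - m - 1)],
    whence the surplus [1 + 1 / q]. *)
Lemma nb_over_ge i c : (i + c.+1 < n)%N ->
  (1 + q%:R^-1) * q%:R ^+ ((n - (i + c.+1)) * c.+1) <= nb_over i (i + c.+1).
Proof.
have q1 : 0 < q%:R :> rat by rewrite ltr0n ltnW // finNzRing_gt1.
elim: c i => [|c IH] i lt.
  have := nb_over_recl (ltnSn i); rewrite nb_overii subSnn qint1 mulr1 mulr1 addn1 => ->.
  have -> : (n - i = (n - i.+2).+2)%N by lia.
  have -> : (n - i.+1 = (n - i.+2).+1)%N by lia.
  rewrite 2!qintSr muln1 !natrD !natrX exprS mulrDl mul1r mulKf ?gt_eqF //.
  by rewrite addrC -addrA lerDr ler0n.
have {IH} := IH i.+1; rewrite addSnnS => /(_ lt) IH.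
set m := (i + c.+2)%N in lt IH *.
have im : (i < m)%N by rewrite /m; lia.
have mi0 : 0 < [m - i]%:R :> rat by rewrite qintR_gt0 // subn_gt0.
rewrite -(ler_pM2r mi0) nb_over_recl // mulnS exprD.
have le : q%:R ^+ (n - m) * [m - i]%:R <= [n - i]%:R :> rat.
  rewrite qintB_expR; have -> : (n - m + (m - i) = n - i)%N by lia.
  by rewrite gerBl ler0n.
have := ler_pM _ _ le IH; rewrite !mulr_ge0 ?exprn_ge0 ?addr_ge0 ?invr_ge0 ?ler0n // => /(_ isT isT).
by apply: le_trans; rewrite le_eqVlt; apply/orP; left; apply/eqP; ring.
Qed.

Lemma nb_over_ratio_step i m : (i < m <= n)%N ->
  (1 - (q%:R ^+ (m - i))^-1) * nb_over i m <= q%:R ^+ (n - m) * nb_over i.+1 m.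
Proof.
move=> /andP[im mn]; have ni0 : 0 < [n - i]%:R :> rat by rewrite qintR_gt0 //; lia.
have q0 : 0 < q%:R :> rat by rewrite ltr0n ltnW // finNzRing_gt1.
rewrite -(ler_pM2l ni0) [leRHS]mulrCA -nb_over_recl // [leRHS]mulrCA qintB_expR.
have -> : (n - m + (m - i) = n - i)%N by lia.
rewrite mulrA [leLHS]mulrC; apply: ler_wpM2l; first exact/ltW/nb_over_gt0.
rewrite mulrBr mulr1 lerD2l lerN2 ler_pdivlMr ?exprn_gt0 // mulrC qintB_expR.
have -> : (m - i + (n - m) = n - i)%N by lia.
by rewrite gerBl ler0n.
Qed.

(** Iterating [nb_over_ratio_step] costs the factors [1 - q ^- l] for
    [m - i <= l <= m].  Since [q >= 3], these exponentially decreasing defects add up to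
    at most [3/2] times the largest one. *)
Lemma nb_over_ratio i m : (3 <= q)%N -> (i < m <= n)%N ->
  (1 - 3/2 * (q%:R ^+ (m - i))^-1) * nb_over 0 m <= q%:R ^+ ((n - m) * i.+1) * nb_over i.+1 m.
Proof.
move=> q3; have q3' : 3 <= q%:R :> rat by rewrite (ler_nat _ 3).
have q0 : 0 < q%:R :> rat by lra.
elim: i => [|i IH] /andP[im mn].
  apply: le_trans; last by rewrite muln1; apply: nb_over_ratio_step; rewrite im.
  rewrite subn0; apply: ler_wpM2r; first exact/ltW/nb_over_gt0.
  have : 0 <= (q%:R ^+ m)^-1 :> rat by rewrite invr_ge0 exprn_ge0 // ltW.
  lra.
have im' : (i < m <= n)%N by rewrite mn (ltnW im).
have {IH} := IH im'; set x := (q%:R ^+ (m - i.+1))^-1; move=> IH.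
have ex : (q%:R ^+ (m - i))^-1 = x / q%:R.
  by rewrite (_ : (m - i = (m - i.+1).+1)%N) ?exprS ?invfM 1?mulrC //; lia.
have x0 : 0 <= x by rewrite invr_ge0 exprn_ge0 // ltW.
have x1 : x <= 1 by rewrite invf_le1 ?exprn_gt0 // exprn_ege1 //; lra.
have xq : x / q%:R <= x / 3 by rewrite ler_wpM2l // lef_pV2 // posrE.
rewrite ex in IH; have st := nb_over_ratio_step (i := i.+1) (m := m); rewrite im mn -/x in st; have {}st := st isT.
 rewrite mulnS exprD -[leRHS]mulrA [leRHS]mulrCA.
apply: le_trans; last by apply: ler_wpM2l st; rewrite exprn_ge0 // ltW.
rewrite [leRHS]mulrCA; apply: le_trans; last by apply: ler_wpM2l IH; rewrite subr_ge0.
rewrite [leRHS]mulrA; apply: ler_wpM2r; first exact/ltW/nb_over_gt0.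
move: (x / q%:R) x0 x1 xq => y; clear; nra.
Qed.

Lemma var_factor1 m : var_factor 1 m = 1.
Proof.
rewrite /var_factor big_nat big1 // => l /andP[l0 _]; rewrite subn1 divff // gt_eqF //.
exact: qintR_gt0.
Qed.

Lemma var_factor_gt0 j m : (0 < j)%N -> 0 < var_factor j m.
Proof.
move=> j0; rewrite /var_factor big_nat; apply: prodr_gt0 => l /andP[jl _].
by rewrite divr_gt0 // qintR_gt0 ?subn_gt0 //; lia.
Qed.

(** The factor [1 + q ^- m] strengthens the bound [2 q ^+ (k m)] enough for the
    induction on [m]: with [x = q ^- m.+1], the step needs
    [1 + x <= (1 + q x) (1 - x)]. *)
Lemma var_factor_le k m : (3 <= q)%N ->
  var_factor k.+1 (k.+1 + m) * (1 + (q%:R ^+ m)^-1) <= 2 * q%:R ^+ (k * m).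
Proof.
move=> q3; have q3' : 3 <= q%:R :> rat by rewrite (ler_nat _ 3).
have q0 : 0 < q%:R :> rat by lra.
elim: m => [|m IH].
  by rewrite addn0 /var_factor big_geq // muln0 expr0 invr1; lra.
rewrite addnS /var_factor big_nat_recr ?leq_addr //= -/(var_factor _ _).
have -> : ((k.+1 + m).+1 - k.+1 = m.+1)%N by lia.
set x := (q%:R ^+ m.+1)^-1.
have ex : (q%:R ^+ m)^-1 = q%:R * x by rewrite /x exprS invfM mulVKf // gt_eqF.
have x0 : 0 < x by rewrite invr_gt0 exprn_gt0.
have qx1 : q%:R * x <= 1 by rewrite -ex invf_le1 ?exprn_gt0 // exprn_ege1 //; lra.
have xlt : x < 1 by nra.
rewrite ex in IH.
have m0 : 0 < [m.+1]%:R :> rat by rewrite qintR_gt0.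
have step : [k.+1 + m]%:R / [m.+1]%:R * (1 - x) <= q%:R ^+ k.
  rewrite mulrAC ler_pdivrMr // addSnnS.
  have -> : q%:R ^+ k * [m.+1]%:R = [k + m.+1]%:R - [k]%:R :> rat by rewrite qintB_expR.
  rewrite mulrBr mulr1 lerD2l lerN2 /x ler_pdivlMr ?exprn_gt0 // mulrC qintB_expR addnC.
  by rewrite gerBl ler0n.
have num : 1 + x <= (1 + q%:R * x) * (1 - x) by nra.
rewrite mulnS exprD [q%:R ^+ k * _]mulrC [leRHS]mulrA.
have l0 : 0 < var_factor k.+1 (k.+1 + m) by apply: var_factor_gt0.
have y0 : 0 <= [k.+1 + m]%:R / [m.+1]%:R :> rat by rewrite divr_ge0 ?ler0n.
have lhs0 : 0 <= var_factor k.+1 (k.+1 + m) * (1 + q%:R * x).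
  by rewrite mulr_ge0 ?ltW // ltr_wpDl // mulr_gt0.
have s0 : 0 <= [k.+1 + m]%:R / [m.+1]%:R * (1 - x) by rewrite mulr_ge0 // subr_ge0 ltW.
move: ([k.+1 + m]%:R / [m.+1]%:R) y0 s0 step => y y0 s0 step.
have := ler_pM lhs0 s0 IH step; apply: le_trans.
rewrite -mulrA -[leRHS]mulrA; apply: ler_wpM2l; first exact: ltW.
by rewrite [leRHS]mulrCA; apply: ler_wpM2l.
Qed.

Lemma var_factor_bound k m : (3 <= q)%N -> (0 < k)%N ->
  q%:R * var_factor k.+1 (k.+1 + m) <= 2 * q%:R ^+ (k * m.+1).
Proof.
move=> q3 k0; have q3' : 3 <= q%:R :> rat by rewrite (ler_nat _ 3).
have q0 : 0 < q%:R :> rat by lra.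
have := var_factor_le k m q3; have : 0 < (q%:R ^+ m)^-1 :> rat by rewrite invr_gt0 exprn_gt0.
have := var_factor_gt0 (k.+1 + m) (ltn0Sn k); move: (var_factor _ _) => l l0; move: (_^-1) => x x0 le.
have {le x x0} le : l <= 2 * q%:R ^+ (k * m) by apply: le_trans le; nra.
rewrite mulnS exprD mulrCA; apply: ler_pM => //; first exact: ltW.
by rewrite ler_eXnr //; lra.
Qed.
End Grassmannian.

(** The inequality on [R], the number of rich subspaces, is [cantelli] divided by their
    total number [N]; the other one compares [N d ^+ 2 / (d ^+ 2 + L mu)] with the
    desired bound, [d] being the gap between the mean [mu] and the threshold [s]. *)
Lemma rich_fraction (N Q R s M L mu d : rat) :
  0 < s -> 0 <= M -> 0 < L -> mu = d + s -> 0 <= d ->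
  N * d ^+ 2 <= R * (d ^+ 2 + L * mu) ->
  Q * (s * (d ^+ 2 + L * mu)) <= N * d ^+ 2 * (s + 2 * M) ->
  s / (s + 2 * M) * Q <= R.
Proof.
move=> s0 M0 L0 emu d0 rich key.
have c0 : 0 < s + 2 * M by lra.
have e0 : 0 < d ^+ 2 + L * mu by rewrite ltr_wpDl ?sqr_ge0 // mulr_gt0 // emu; lra.
rewrite mulrAC ler_pdivrMr // -(ler_pM2r e0).
have := ler_wpM2r (ltW c0) rich; have := key.
rewrite (_ : R * (s + _) * _ = R * (d ^+ 2 + L * mu) * (s + 2 * M)); last by ring.
rewrite (_ : s * Q * _ = Q * (s * (d ^+ 2 + L * mu))); last by ring.
exact: le_trans.
Qed.

(** Both [L] and the power [M] enter linearly, so only the quadratic inequality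
    [s (d + s) <= 4 d ^+ 2] matters, where [4] is a lower bound of [(1 + 1/q) q]. *)
Lemma moment_ineq_pos (q s M L d : rat) :
  3 <= q -> 0 < s -> 0 < L -> q * L <= 2 * M -> 2 / 3 * s <= d ->
  s * (d ^+ 2 + L * (d + s)) <= (1 + q^-1) * d ^+ 2 * (s + 2 * M).
Proof.
move=> q3 s0 L0 LM ds.
have quad : s * (d + s) <= 4 * d ^+ 2 by nra.
have q0 : 0 < q^-1 by rewrite invr_gt0; lra.
have gM : 4 * L <= (1 + q^-1) * (2 * M).
  have : (1 + q^-1) * (q * L) <= (1 + q^-1) * (2 * M) by rewrite ler_wpM2l //; lra.
  apply: le_trans; have -> : (1 + q^-1) * (q * L) = (q + 1) * L by field; lra.
  by apply: (ler_wpM2r (ltW L0)); lra.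
have p1 : 0 <= L * (4 * d ^+ 2 - s * (d + s)) by rewrite mulr_ge0 ?subr_ge0 // ltW.
have p2 : 0 <= d ^+ 2 * ((1 + q^-1) * (2 * M) - 4 * L) by rewrite mulr_ge0 ?sqr_ge0 ?subr_ge0.
have p3 : 0 <= d ^+ 2 * (q^-1 * s) by rewrite mulr_ge0 ?sqr_ge0 // mulr_ge0 // ltW.
nra.
Qed.

(** With [u = 1/q], replacing the factor [s] by [1] in the surplus [u s] leaves
    [s (d + s) <= (2 + 3 u) d ^+ 2], whose worst case is [d = (1 - 2 u ^+ 2) s]. *)
Lemma moment_ineq_zero (u s d : rat) :
  0 < u <= 1 / 3 -> 1 <= s -> (1 - 2 * u ^+ 2) * s <= d ->
  s * (d ^+ 2 + (d + s)) <= (1 + u) * d ^+ 2 * (s + 2).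
Proof.
move=> /andP[u0 u3] s1 ds; set rho := 1 - 2 * u ^+ 2 in ds.
have r79 : 7 / 9 <= rho by rewrite /rho; nra.
have poly : 1 + rho <= (2 + 3 * u) * rho ^+ 2.
  have : 0 <= u * (3 - 6 * u - 12 * u ^+ 2 + 8 * u ^+ 3 + 12 * u ^+ 4).
    apply: mulr_ge0; first exact: ltW.
    pose w := 1 / 3 - u; have -> : u = 1 / 3 - w by rewrite /w; ring.
    have w0 : 0 <= w by rewrite /w; lra.
    have w1 : w <= 1 / 3 by rewrite /w; lra.
    nra.
  rewrite /rho; lra.
have quad : s * (d + s) <= (2 + 3 * u) * d ^+ 2.
  have := mulr_ge0 (sqr_ge0 s) (_ : 0 <= (2 + 3 * u) * rho ^+ 2 - (1 + rho)).
  rewrite subr_ge0 => /(_ poly).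
  have : 0 <= (d - rho * s) * ((2 + 3 * u) * (d + rho * s) - s).
    apply: mulr_ge0; first by lra.
    have : 0 <= u * (d + rho * s) by apply: mulr_ge0; [exact: ltW | nra].
    nra.
  lra.
have : 0 <= d ^+ 2 * (u * (s - 1)) by rewrite mulr_ge0 ?sqr_ge0 // mulr_ge0 ?subr_ge0 // ltW.
nra.
Qed.

(** * Rich linear subspaces *)

(** The mean is at least [2 s r], where [r] is at least [1 - u ^+ 2] if [k = 0] and
    [1 - 3/2 u ^+ 2 >= 5/6] otherwise; so the gap [mu - s] is at least
    [(2 r - 1) s], to which the two moment inequalities apply. *)
Lemma rich_subspaces (F : finFieldType) (n k h : nat) (K : {set 'M[F]_n}) (s : rat) :
    (3 <= #|F|)%N -> (k < h)%N -> (h.+1 < n)%N -> K \subset Gr F n k.+1 ->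
    1 <= s -> 2 * s * #|F|%:R ^+ ((n - h.+1) * k.+1) <= #|K|%:R ->
  s / (s + 2 * #|F|%:R ^+ (k * (h - k + 1))) * #|F|%:R ^+ ((n - h.+1) * h.+1)
    <= #|[set W in Gr F n h.+1 | s < #|[set V in K | (V <= W)%MS]|%:R]|%:R.
Proof.
move=> q3n kh hn KG s1 cK.
have jmn : (k.+1 <= h.+1 <= n)%N by rewrite ltnS (ltnW kh) ltnW.
have [sX vX] := variance_bound jmn KG.
set N := nb_over F n 0 h.+1 in sX vX; set D := nb_over F n k.+1 h.+1 in sX vX.
set L := var_factor F k.+1 h.+1 in vX; set mu := _ / N in sX vX.
set Q := _ ^+ ((n - _) * h.+1); set M := _ ^+ (k * _); set R : nat := #|_|.
have q3 : 3 <= #|F|%:R :> rat by rewrite (ler_nat _ 3).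
have q0 : 0 < #|F|%:R :> rat by apply: lt_le_trans q3.
pose u : rat := #|F|%:R^-1.
have u0 : 0 < u by rewrite invr_gt0.
have u3 : u <= 1 / 3 by rewrite div1r lef_pV2.
have u1 : u <= 1 by clear -u3; lra.
have u2 : u ^+ 2 <= 1 / 9 by clear -u0 u3; nra.
have N0 : 0 < N by apply: nb_over_gt0; apply: ltnW.
have D0 : 0 < D by apply: nb_over_gt0; apply: ltnW.
have L0 : 0 < L by apply: var_factor_gt0.
have Q0 : 0 < Q by apply: exprn_gt0.
have M0 : 0 < M by apply: exprn_gt0.
have s0 : 0 < s by apply: lt_le_trans s1.
have NQ : (1 + u) * Q <= N by have := @nb_over_ge F n 0 h hn.
have eN : #|Gr F n h.+1|%:R = N by apply: card_Gr; apply: ltnW.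
have mu_ge r : r * N <= #|F|%:R ^+ ((n - h.+1) * k.+1) * D -> 2 * s * r <= mu.
  move=> rN; rewrite /mu ler_pdivlMr // -[leLHS]mulrA.
  apply: le_trans (ler_wpM2l _ rN) _; first by rewrite mulr_ge0 // ltW.
  by rewrite mulrA [leRHS]mulrC ler_pM2r.
have bound : s < mu ->
    s * ((mu - s) ^+ 2 + L * (mu - s + s)) <= (1 + u) * (mu - s) ^+ 2 * (s + 2 * M) ->
    s / (s + 2 * M) * Q <= R%:R.
  move=> lt key; have d0 : 0 <= mu - s by rewrite subr_ge0 ltW.
  apply: (@rich_fraction N Q _ s M L mu (mu - s)) => //; rewrite ?subrK ?(ltW M0) //.
    have := cantelli sX vX lt; rewrite eN.
    have -> : L * D * #|K|%:R = N * (L * mu) by rewrite /mu; field; rewrite gt_eqF.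
    by rewrite exprMn -mulrDr [N ^+ 2]expr2 -[leLHS]mulrA [leRHS]mulrCA ler_pM2l.
  rewrite subrK in key; apply: le_trans (ler_wpM2l (ltW Q0) key) _.
  have dd : 0 <= (mu - s) ^+ 2 * (s + 2 * M).
    by rewrite mulr_ge0 ?sqr_ge0 // addr_ge0 ?mulr_ge0 // ltW.
  have := ler_wpM2r dd NQ; rewrite !mulrA; apply: le_trans.
  by rewrite le_eqVlt; apply/orP; left; apply/eqP; ring.
have Vu m : (2 <= m)%N -> (#|F|%:R ^+ m)^-1 <= u ^+ 2.
  by move=> m2; rewrite -exprVn; apply: ler_wiXn2l => //; apply: ltW.
case: (posnP k) => [k0|k0].
  have r0 : 2 * s * (1 - (#|F|%:R ^+ h.+1)^-1) <= mu.
    have := @nb_over_ratio_step F n 0 h.+1 (ltnW hn); rewrite subn0 => st.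
    by apply: mu_ge; rewrite /D k0 muln1.
  have uh : (#|F|%:R ^+ h.+1)^-1 <= u ^+ 2 by apply: Vu; rewrite ltnS (leq_trans _ kh).
  have ds : (1 - 2 * u ^+ 2) * s <= mu - s.
    by have := ler_wpM2l (ltW s0) uh; clear -r0; lra.
  have d0 : 0 < mu - s.
    by apply: lt_le_trans ds; apply: mulr_gt0 => //; clear -u2; lra.
  apply: bound; first by rewrite -subr_gt0.
  rewrite /L /M k0 var_factor1 mul0n expr0 !mul1r mulr1.
  by apply: moment_ineq_zero => //; rewrite u0.
have r0 : 2 * s * (1 - 3 / 2 * (#|F|%:R ^+ (h.+1 - k))^-1) <= mu.
  by apply: mu_ge; apply: nb_over_ratio => //; rewrite ltnS (ltnW kh) ltnW.
have uh : (#|F|%:R ^+ (h.+1 - k))^-1 <= u ^+ 2 by apply: Vu; rewrite ltn_subRL addn1.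
have ds : 2 / 3 * s <= mu - s.
  by have := ler_wpM2l (ltW s0) (le_trans uh u2); clear -r0; lra.
have d0 : 0 < mu - s by apply: lt_le_trans ds; apply: mulr_gt0; first by clear; lra.
apply: bound; first by rewrite -subr_gt0.
apply: (moment_ineq_pos q3 s0 L0 _ ds).
by have := var_factor_bound (h - k) q3n k0; rewrite /L /M addn1 addSn subnKC // ltnW.
Qed.

(** * Affine planes as traces of linear subspaces *)

Section Homogenization.
Variables (F : finFieldType) (d : nat).
Local Notation q := #|F|.
Implicit Types (A B : 'M[F]_(1 + d)) (w x : 'rV[F]_d).

Definition hom x : 'rV[F]_(1 + d) := row_mx 1%:M x.

Definition aff A : {set 'rV[F]_d} := [set x | (hom x <= A)%MS].

Lemma affS A B : (A <= B)%MS -> aff A \subset aff B.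
Proof. by move=> AB; apply/subsetP=> x; rewrite !inE => /submx_trans; apply. Qed.

Lemma row_mx_hom (c : F) x w : row_mx c%:M (x + (c - 1) *: w) = hom x + (c - 1) *: hom w.
Proof.
rewrite /hom scale_row_mx add_row_mx; congr row_mx.
by apply/matrixP=> i j; rewrite !ord1 !mxE eqxx !mulr1n; ring.
Qed.

Lemma hom_rsubmx (v : 'rV[F]_(1 + d)) w :
  hom (rsubmx v - (v 0 0 - 1) *: w) = v - (v 0 0 - 1) *: hom w.
Proof.
apply/eqP; rewrite -subr_eq opprK -row_mx_hom subrK -[eqbRHS]hsubmxK; apply/eqP.
congr row_mx; rewrite [RHS]mx11_scalar mxE; congr (v _ _)%:M; exact: val_inj.
Qed.

(** Through a point [w] of the trace, every vector [v] of [A] is, up to a multiple of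
    [hom w], of the form [hom x] with [x] in the trace. *)
Lemma sub_aff A B w : w \in aff A -> aff A \subset aff B -> (A <= B)%MS.
Proof.
move=> wA AB; have wB := subsetP AB w wA; move: (wA) (wB); rewrite !inE => hwA hwB.
apply/rV_subP=> v vA; rewrite -[v](subrK ((v 0 0 - 1) *: hom w)) -hom_rsubmx.
set x := _ - _; have xA : x \in aff A.
  by rewrite inE /x hom_rsubmx addmx_sub // eqmx_opp scalemx_sub.
have := subsetP AB x xA; rewrite inE => hxB.
by rewrite addmx_sub // scalemx_sub.
Qed.

Lemma aff_inj A B i j w : A \in Gr F (1 + d) i -> B \in Gr F (1 + d) j ->
  w \in aff A -> aff A = aff B -> A = B.
Proof.
move=> Ai Bj wA AB; have AB' : (A <= B)%MS by apply: (sub_aff wA); rewrite AB.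
apply: (Gr_inj Ai Bj AB'); rewrite -(rank_Gr Ai) -(rank_Gr Bj) mxrankS //.
by apply: (@sub_aff _ _ w); rewrite -AB.
Qed.

(** Splitting a vector by its first coordinate, all the slices of [A] are translates
    of the trace. *)
Lemma card_aff A w : w \in aff A -> (q ^ \rank A = q * #|aff A|)%N.
Proof.
move=> wA; rewrite -card_submx -[in RHS]cardsT -cardsX.
pose g (p : F * 'rV[F]_d) := row_mx p.1%:M (p.2 + (p.1 - 1) *: w).
have g_inj : injective g.
  case=> c x [c' x'] /eq_row_mx[/= /matrixP/(_ 0 0)]; rewrite !mxE eqxx !mulr1n => <-.
  by move/addIr->.
rewrite -(card_imset _ g_inj); apply: eq_card => v; rewrite inE.
move: (wA); rewrite inE => hwA; apply/idP/imsetP => [vA|[[c x]]].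
  exists (v 0 0, rsubmx v - (v 0 0 - 1) *: w); last by rewrite /g /= row_mx_hom hom_rsubmx subrK.
  by rewrite inE /= inE /= inE hom_rsubmx addmx_sub // eqmx_opp scalemx_sub.
by rewrite !inE /g /= row_mx_hom => xA ->; rewrite addmx_sub // scalemx_sub.
Qed.

(** The direction of the trace consists of the [x] with [(0, x)] in [A]; its dimension
    is read off from [card_aff]. *)
Lemma aff_is_plane h H w : H \in Gr F (1 + d) h.+1 -> w \in aff H -> is_plane h (aff H).
Proof.
move=> Hh wH; pose M := (row_mx (0 : 'M[F]_(d, 1)) 1%:M) *m cokermx H.
pose U := lker (linfun (mulmxr M : 'rV[F]_d -> 'rV[F]_(1 + d))).
have memU x : (x \in U) = (row_mx 0 x <= H)%MS.
  by rewrite memv_ker lfunE /= /M mulmxA mul_mx_row mulmx0 mulmx1 submxE.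
have affU : aff H = [set x + w | x in U].
  have e x : row_mx 0 x = hom (x + w) - hom w.
    by rewrite /hom opp_row_mx add_row_mx subrr addrK.
  move: (wH); rewrite inE => hwH; apply/setP=> y; apply/idP/imsetP => [|[x xU ->]].
    rewrite inE => hy; exists (y - w); last by rewrite subrK.
    by rewrite memU e subrK addmx_sub // eqmx_opp.
  rewrite inE; have -> : hom (x + w) = row_mx 0 x + hom w by rewrite e subrK.
  by rewrite addmx_sub // -memU.
have dimU : \dim U = h.
  have := card_aff wH; rewrite (rank_Gr Hh) affU card_imset; last exact: addIr.
  by rewrite card_vspace -expnS => /expnI; rewrite finNzRing_gt1 => /(_ isT) [].
case: h / dimU {Hh}; apply/existsP; exists (vbasis U); apply/existsP; exists w.
by rewrite !(span_basis (vbasisP U)) affU !eqxx.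
Qed.

(** Take all [(c, y)] with [y - c w] in the direction of the plane, [w] being one of its
    points; [card_aff] gives the rank. *)
Lemma is_plane_aff k V : is_plane k V ->
  exists2 A, A \in Gr F (1 + d) k.+1 & aff A = V /\ V != set0.
Proof.
case/existsP=> vs /existsP[w /andP[/eqP dimU /eqP eV]]; set U := <<vs>>%VS in dimU eV.
pose S (v : 'rV[F]_(1 + d)) := rsubmx v - v 0 0 *: w \in U.
pose A0 := (\sum_(v | S v) <<v>>)%MS.
have memA0 v : (v <= A0)%MS = S v.
  apply/idP/idP=> [/sub_sumsmxP[u ->]|Sv]; last by apply: (sumsmx_sup v); rewrite ?genmxE.
  apply: (big_ind S) => [|x y|v' Sv'].
  - by rewrite /S linear0 mxE scale0r subrr mem0v.
  - by rewrite /S linearD mxE scalerDl opprD addrACA; apply: memvD.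
  have /sub_rVP[a ->] : (u v' *m <<v'>>%MS <= v')%MS by rewrite (submx_trans (submxMl _ _)) ?genmxE.
  rewrite /S linearZ mxE -scalerA -scalerBr.
  exact: memvZ.
have hom0 x : hom x 0 0 = 1.
  rewrite (_ : hom x 0 0 = hom x 0 (lshift d 0)); last by congr (hom x _ _); apply: val_inj.
  by rewrite /hom row_mxEl mxE.
have affA0 : aff A0 = V.
  apply/setP=> y; rewrite inE memA0 /S hom0 scale1r row_mxKr eV.
  apply/idP/imsetP=> [yU|[x xU ->]]; last by rewrite addrK.
  by exists (y - w); rewrite ?subrK.
have wV : w \in V by rewrite eV; apply/imsetP; exists 0; rewrite ?mem0v ?add0r.
exists <<A0>>%MS; last first.
  split; last by apply/set0Pn; exists w.
  by rewrite -affA0; apply/setP=> x; rewrite !inE genmxE.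
have wA : w \in aff A0 by rewrite affA0.
suff <- : \rank A0 = k.+1 by apply: mem_genmx_Gr.
have := card_aff wA; rewrite affA0 eV card_imset; last exact: addIr.
by rewrite card_vspace dimU -expnS => /expnI; apply; apply: finNzRing_gt1.
Qed.

(** [K'] consists of the linear subspaces whose trace belongs to [K].  Distinct
    subspaces that meet [x_0 = 1] have distinct traces, so passing to traces loses
    neither rich subspaces nor the members of [K'] that they contain; both meet
    [x_0 = 1] because they contain a plane of [K] there. *)
Lemma rich_planes_ge k h t (K : {set {set 'rV[F]_d}}) :
    (0 < t)%N -> (forall V, V \in K -> is_plane k V) ->
  exists2 K' : {set 'M[F]_(1 + d)}, K' \subset Gr F (1 + d) k.+1 /\ (#|K| <= #|K'|)%N &
  (#|[set W in Gr F (1 + d) h.+1 | (t <= #|[set V in K' | (V <= W)%MS]|)%N]|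
     <= #|rich_planes h t K|)%N.
Proof.
move=> t0 hK; pose K' := [set A in Gr F (1 + d) k.+1 | aff A \in K].
have ne A : A \in K' -> exists w, w \in aff A.
  rewrite inE => /andP[_ /hK/is_plane_aff[_ _ [_ /set0Pn]]] //.
exists K'.
  split; first by apply/subsetP=> A; rewrite inE => /andP[].
  apply: leq_trans (leq_imset_card aff _); apply/subset_leq_card/subsetP=> V VK.
  have [A Ak [eA _]] := is_plane_aff (hK _ VK).
  by apply/imsetP; exists A; rewrite ?inE ?Ak eA.
set R := [set W in _ | _].
have neR W : W \in R -> exists w, w \in aff W.
  rewrite inE => /andP[_ /(leq_trans t0)/card_gt0P[V]]; rewrite inE => /andP[/ne[w wV] VW].
  by exists w; apply: subsetP (affS VW) w wV.
have R_inj : {in R &, injective aff}.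
  move=> W W' WR W'R; have [w wW] := neR W WR.
  by move: WR W'R; rewrite !inE => /andP[Wh _] /andP[W'h _]; exact: (aff_inj Wh W'h wW).
rewrite -(card_in_imset R_inj); apply/subset_leq_card/subsetP=> _ /imsetP[W WR ->].
have [w wW] := neR W WR; move: WR; rewrite !inE => /andP[Wh tW].
rewrite (aff_is_plane Wh wW) (leq_trans tW) //.
have K_inj : {in [set V in K' | (V <= W)%MS] &, injective aff}.
  move=> A B; rewrite !inE => /andP[/andP[Ak AK] _] /andP[/andP[Bk _] _].
  have [x xA] : exists x, x \in aff A by apply: ne; rewrite inE Ak.
  exact: (aff_inj Ak Bk xA).
rewrite -(card_in_imset K_inj); apply/subset_leq_card/subsetP=> _ /imsetP[A + ->].
by rewrite !inE => /andP[/andP[_ ->] /affS].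
Qed.

End Homogenization.

Theorem theorem1p9 (F : finFieldType) (q k h d t : nat)
    (hq : #|F| = q) (q_odd : odd q)
    (hkh : (k < h)%N) (hhd : (h < d)%N) (ht : (2 <= t)%N)
    (K : {set {set 'rV[F]_d}})
    (hK : forall V : {set 'rV[F]_d}, V \in K -> is_plane k V)
    (hcard : (2 * (t - 1) * q ^ ((d - h) * (k + 1)) <= #|K|)%N) :
  rich_const q k h t * q%:R ^+ ((d - h) * (h + 1)) <= #|rich_planes h t K|%:R.
Proof.
subst q; have q3 : (3 <= #|F|)%N.
  by have := finNzRing_gt1 F; case: #|F| q_odd => [|[|[|]]].
have [K' [K'G KK'] rich] := rich_planes_ge h (ltnW ht) hK.
have hn : (h.+1 < 1 + d)%N by rewrite add1n.
have nh : (1 + d - h.+1 = d - h)%N by rewrite add1n.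
pose s : rat := t%:R - 1.
have s1 : 1 <= s by rewrite /s lerBrDr (ler_nat _ 2).
have es : (t - 1)%:R = s by rewrite natrB // ltnW.
have cK : 2 * s * #|F|%:R ^+ ((1 + d - h.+1) * k.+1) <= #|K'|%:R.
  by rewrite nh -es -natrX -!natrM ler_nat -(addn1 k); apply: leq_trans hcard KK'.
have := rich_subspaces q3 hkh hn K'G s1 cK.
rewrite nh -(addn1 h) => /le_trans; apply.
rewrite ler_nat; apply: leq_trans rich; rewrite addn1; apply/subset_leq_card/subsetP=> W.
by rewrite !inE => /andP[->] /=; rewrite /s ltrBlDr natr1 ltr_nat ltnS.
Qed.
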